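(* For each prime power $q$, there exists a positive integer $n$ such that, if $M$ is a round matroid with a $\mathrm{PG}(n-1,q)$-minor but no $U_{2,q^2+1}$-minor, then $\epsilon(M) \le \frac{q^{r(M)}-1}{q-1}$.
   Context: A matroid $M$ is round if $E(M)$ cannot be partitioned into two sets each of rank less than $r(M)$. A point of $M$ is a rank-$1$ flat, and $\epsilon(M)$ denotes the number of points of $M$. $\mathrm{PG}(n-1,q)$ is the rank-$n$ projective geometry over $\mathrm{GF}(q)$; $U_{2,m}$ is the uniform matroid of rank $2$ on $m$ elements. *)

(* Defs.v *)
From mathcomp Require Import all_boot all_order all_algebra.
Set Implicit Arguments. Unset Strict Implicit. Unset Printing Implicit Defensive.
Import GRing.Theory.

(* Matroids are given by their rank function on the full ground set T. *)
Definition is_matroid (T : finType) (r : {set T} -> nat) : Prop :=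
  [/\ (forall X, r X <= #|X|),
      (forall X Y : {set T}, X \subset Y -> r X <= r Y) &
      (forall X Y : {set T}, r (X :|: Y) + r (X :&: Y) <= r X + r Y)].

Definition round (T : finType) (r : {set T} -> nat) : Prop :=
  ~ (exists X : {set T}, r X < r setT /\ r (~: X) < r setT).

Definition is_flat (T : finType) (r : {set T} -> nat) (X : {set T}) : bool :=
  [forall e, (e \notin X) ==> (r X < r (e |: X))].

Definition num_points (T : finType) (r : {set T} -> nat) : nat :=
  #|[set X : {set T} | is_flat r X && (r X == 1)]|.

(* M (rank r on T) has a minor isomorphic to N (rank rN on T'):
   N is isomorphic, via the injection f, to M / C \ D where
   D = T \ (C u f(T')); the rank in M/C of Y is r(Y u C) - r(C). *)
Definition has_minor (T T' : finType) (r : {set T} -> nat)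
  (rN : {set T'} -> nat) : Prop :=
  exists (C : {set T}) (f : T' -> T),
    [/\ injective f, [disjoint (f @: setT) & C] &
        forall X : {set T'}, rN X = r ((f @: X) :|: C) - r C].

Definition U2_rank (m : nat) (X : {set 'I_m}) : nat := minn #|X| 2.

(* PG(n-1, F): points of the projective space represented by the nonzero
   vectors of F^n whose first nonzero coordinate is 1. *)
Definition normalized (F : finFieldType) (n : nat) (v : 'rV[F]_n) : bool :=
  [exists i : 'I_n, (v 0 i == 1)%R && [forall j : 'I_n, (j < i)%N ==> (v 0 j == 0)%R]].

Definition PGpt (F : finFieldType) (n : nat) := {v : 'rV[F]_n | normalized v}.

Definition PG_rank (F : finFieldType) (n : nat) (X : {set PGpt F n}) : nat :=
  \dim (<< [seq val x | x <- enum X] >>%VS).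

Definition prime_power (q : nat) : Prop :=
  exists p k, [/\ prime p, (0 < k)%N & q = p ^ k].

(* Main.v *)
Require Import Defs.
From mathcomp Require Import all_boot all_order all_algebra all_field.
From mathcomp Require Import zify ring.
Set Implicit Arguments. Unset Strict Implicit. Unset Printing Implicit Defensive.
Import GRing.Theory.

(* If R is a PG(2,q)-restriction and e is a new point in its span, then M/e has
   a line with q^2+1 points; so every point spanned by R is parallel to a point
   of R. If M is round and L is a line with q+2 points, we may contract points
   outside cl(L) and cl(R) until R spans, which is then impossible. Hence all
   lines have at most q+1 points, and contracting a point outside cl(R) gives
   the bound by induction on the rank.

   For a PG(n-1,q)-minor R of M/C, points of C outside cl(L) can be contracted,
   so that C has rank at most 2. The elements of C are then removed one at a
   time: if M/e has a large PG-restriction, the points of an affine part of it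
   are coloured by their parallel classes on a line through e obtained by
   contracting a basis of the hyperplane at infinity. This line has at most q^2
   points, so by the Hales-Jewett theorem some affine subspace is
   monochromatic, which means that its span avoids e. Contracting one point a
   of it outside cl(L) produces a PG-restriction of M/a. *)

(** * The Hales-Jewett theorem *)

(** A word over [option A] stands for a combinatorial line, with [None] at its moving
    coordinates. *)
Definition inst (A : Type) (t : seq (option A)) (a : A) : seq A :=
  [seq odflt a x | x <- t].

Lemma size_inst (A : Type) (t : seq (option A)) (a : A) : size (inst t a) = size t.
Proof. exact: size_map. Qed.

Lemma inst_cat (A : Type) (t s : seq (option A)) (a : A) :
  inst (t ++ s) a = inst t a ++ inst s a.
Proof. exact: map_cat. Qed.

Lemma inst_Some (A : Type) (w : seq A) (a : A) : inst [seq Some x | x <- w] a = w.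
Proof. by elim: w => //= x w; rewrite /inst /= => ->. Qed.

(** Constancy is asked only for letters in [l], so that an induction can admit the letters of a
    fixed alphabet one by one. *)
Definition mono_line (A : finType) (D : Type) (l : seq A) (chi : seq A -> D)
    (t : seq (option A)) : Prop :=
  None \in t /\ {in l &, forall a b, chi (inst t a) = chi (inst t b)}.

(* Colour focusing: all lines of [ts] are monochromatic on [l], have pairwise
   distinct colours, and pass through the same word [f] at the new letter [b]. *)
Lemma focused_lines (A : finType) (b a0 : A) (l : seq A) (c : nat) :
  a0 \in l ->
  (forall c', exists N, forall (D : finType) (chi : seq A -> D), #|D| = c' ->
     exists t, size t = N /\ mono_line l chi t) ->
  forall j, exists N, forall (D : finType) (chi : seq A -> D), #|D| = c ->
    (exists t, size t = N /\ mono_line (b :: l) chi t) \/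
    (exists (ts : seq (seq (option A))) (f : seq A),
       [/\ size f = N, size ts = j,
           {in ts, forall t, mono_line l chi t /\ inst t b = f} &
           uniq [seq chi (inst t a0) | t <- ts]]).
Proof.
move=> la0 HJl; elim=> [|j [N1 IH]].
  by exists 0 => D chi _; right; exists [::], [::].
(* A suffix will be coloured by the function sending each prefix of length [N1] to the colour of the
   concatenation; hence this number of colours. *)
have [N2 H2] := HJl (c ^ #|{: N1.-tuple A}|).
exists (N1 + N2) => D chi cD.
pose chi2 w : {ffun N1.-tuple A -> D} := [ffun u : N1.-tuple A => chi (u ++ w)].
have [|s [ss [sN sm]]] := H2 _ chi2; first by rewrite card_ffun cD.
have sE u a : size u = N1 -> a \in l -> chi (u ++ inst s a) = chi (u ++ inst s a0).
  move=> /eqP su la; move: (sm a a0 la la0) => /ffunP/(_ (Tuple su)).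
  by rewrite !ffunE.
have [[t [st [tN tm]]]|[ts [f [sf sts tsm tsu]]]] :=
  IH D (fun u => chi (u ++ inst s a0)) cD.
  left; exists (t ++ [seq Some x | x <- inst s a0]).
  split; first by rewrite size_cat size_map size_inst st ss.
  split; first by rewrite mem_cat tN.
  by move=> a a' la la'; rewrite !inst_cat !inst_Some; apply: tm.
have [/mapP[t tts ct]|nct] :=
  boolP (chi (f ++ inst s a0) \in [seq chi (inst t a0 ++ inst s a0) | t <- ts]).
  left; exists (t ++ [seq Some x | x <- inst s a0]).
  have [[tN tm] tf] := tsm t tts.
  have st : size t = N1 by rewrite -(size_inst t b) tf.
  split; first by rewrite size_cat size_map size_inst st ss.
  split; first by rewrite mem_cat tN.
  have E a : a \in b :: l -> chi (inst t a ++ inst s a0) = chi (f ++ inst s a0).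
    by rewrite inE => /predU1P[->|la]; [rewrite tf | rewrite ct; apply: tm].
  by move=> a a' la la'; rewrite !inst_cat !inst_Some !E.
(* Otherwise [f] followed by [s] is a line of a new colour; the old lines are continued along [s]
   too, so that all meet at [f ++ inst s b]. *)
right; exists (([seq Some x | x <- f] ++ s) :: [seq t ++ s | t <- ts]),
  (f ++ inst s b); split.
- by rewrite size_cat size_inst sf ss.
- by rewrite /= size_map sts.
- move=> t; rewrite inE => /predU1P[->|/mapP[{}t tts ->]].
    split; last by rewrite inst_cat inst_Some.
    split; first by rewrite mem_cat sN orbT.
    by move=> a a' la la'; rewrite !inst_cat !inst_Some !sE.
  have [[tN tm] tf] := tsm t tts.
  have st : size t = N1 by rewrite -(size_inst t b) tf.
  split; last by rewrite inst_cat tf.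
  split; first by rewrite mem_cat tN.
  by move=> a a' la la'; rewrite !inst_cat !sE ?size_inst // (tm a a').
rewrite /= inst_cat inst_Some -map_comp.
by under eq_map => t do rewrite /= inst_cat; rewrite nct.
Qed.

(** Induction on the letters: [c.+1] focused lines would need [c.+1] distinct colours, so
    [focused_lines] must give its first alternative. *)
Lemma hales_jewett_letters (A : finType) (l : seq A) (c : nat) :
  exists N, forall (D : finType) (chi : seq A -> D), #|D| = c ->
    exists t, size t = N /\ mono_line l chi t.
Proof.
elim: l c => [|b [|a0 l] IH] c.
- by exists 1 => D chi _; exists [:: None].
- exists 1 => D chi _; exists [:: None]; split=> //; split=> // a a'.
  by rewrite !inE => /eqP-> /eqP->.
have [|N HN] := @focused_lines A b a0 (a0 :: l) c (mem_head _ _) _ c.+1.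
  exact: IH.
exists N => D chi cD; have [//|[ts [f [_ sts _ /card_uniqP]]]] := HN D chi cD.
by rewrite size_map sts => E; move: (max_card [in [seq chi (inst t a0) | t <- ts]]);
   rewrite E cD ltnn.
Qed.

(** [N] has to depend on the two sizes only, because the alphabet will be a vector space over a
    field that is chosen later. *)
Lemma hales_jewett (k c : nat) :
  exists N, forall (A D : finType) (chi : seq A -> D), #|A| = k -> #|D| = c ->
    exists t, size t = N /\ mono_line (enum A) chi t.
Proof.
have [N HN] := hales_jewett_letters (enum 'I_k) c.
exists N => A D chi cA cD; rewrite -{}cA in HN.
have [t [st [tN tm]]] := HN D (fun w => chi [seq enum_val i | i <- w]) cD.
exists [seq omap enum_val x | x <- t]; split; first by rewrite size_map.
split; first by apply/mapP; exists None.
move=> a a' _ _.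
have E x : inst [seq omap enum_val x | x <- t] x
         = [seq enum_val i | i <- inst t (enum_rank x)].
  by rewrite /inst -!map_comp; apply: eq_map => -[y|] //=; rewrite enum_rankK.
by rewrite !E; apply: tm; rewrite mem_enum.
Qed.

(** * Matroids and contraction *)

(** The ground set is kept and the elements of [K] become loops, so that iterated contractions stay
    on one type. *)
Definition contract (T : finType) (r : {set T} -> nat) (K X : {set T}) : nat :=
  r (X :|: K) - r K.

(** The case [x = y] excludes loops. *)
Definition simple_set (T : finType) (r : {set T} -> nat) (S : {set T}) : Prop :=
  {in S &, forall x y, r [set x; y] = (x != y).+1}.

(* M has no [U_{2,m+1}]-minor. *)
Definition short_lines (T : finType) (r : {set T} -> nat) (m : nat) : Prop :=
  forall K S : {set T}, simple_set (contract r K) S -> contract r K S <= 2 ->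
    #|S| <= m.

Ltac set_incl :=
  let t := fresh "t" in
  apply/subsetP => t; rewrite !inE;
  repeat match goal with |- context [t == ?x] => case: (t == x) => //= end;
  repeat match goal with |- context [t \in ?X] => case: (t \in X) => //= end.

Section RankFunction.

Variables (T : finType) (r : {set T} -> nat).
Hypothesis rM : is_matroid r.

Lemma rank_sub (X Y : {set T}) : X \subset Y -> r X <= r Y.
Proof. by case: rM => _ + _; apply. Qed.

(** Submodularity and monotonicity in one form, which asks for inclusions instead of exact unions
    and intersections. *)
Lemma rank_submod (X Y Z W : {set T}) :
  Z \subset X :|: Y -> W \subset X -> W \subset Y -> r Z + r W <= r X + r Y.
Proof.
move=> ZXY WX WY; case: rM => _ _ /(_ X Y); apply: leq_trans.
by apply: leq_add; apply: rank_sub; rewrite // subsetI WX WY.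
Qed.

Lemma rank0 : r set0 = 0.
Proof. by case: rM => /(_ set0) + _ _; rewrite cards0; case: (r set0). Qed.

Lemma rankU (X Y : {set T}) : r (X :|: Y) <= r X + r Y.
Proof.
have := @rank_submod X Y _ set0 (subxx _) (sub0set _) (sub0set _).
by rewrite rank0 addn0.
Qed.

Lemma rank1 (x : T) : r [set x] <= 1.
Proof. by case: rM => /(_ [set x]) + _ _; rewrite cards1. Qed.

Lemma rankU1 (x : T) (X : {set T}) : r (x |: X) <= (r X).+1.
Proof. by have := rankU [set x] X; have := rank1 x; lia. Qed.

Lemma rankU1_ge (x : T) (X : {set T}) : r X <= r (x |: X).
Proof. exact/rank_sub/subsetUr. Qed.

(** If no element of [Y] raised the rank of [X], a maximal [Z] in [Y] with [r (X :|: Z) = r X] would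
    absorb each of them by submodularity, so [Z = Y]. *)
Lemma rank_ex_U1 (X Y : {set T}) :
  r X < r (X :|: Y) -> exists2 x, x \in Y & r (x |: X) = (r X).+1.
Proof.
have [/existsP[x /andP[xY /eqP xE]]|] :=
  boolP [exists x, (x \in Y) && (r (x |: X) == (r X).+1)]; first by exists x.
rewrite negb_exists => /forallP H; rewrite ltnNge => /negP[].
have E x : x \in Y -> r (x |: X) = r X.
  move=> xY; move: (H x); rewrite xY /= => /eqP.
  by have := rankU1 x X; have := rankU1_ge x X; lia.
have [Z /maxsetP[/andP[ZY /eqP ZX] Zmax] _] :=
  @maxset_exists T [pred Z : {set T} | (Z \subset Y) && (r (X :|: Z) == r X)] set0
    (introT andP (conj (sub0set _) (introT eqP (congr1 r (setU0 X))))).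
suff -> : Y = Z by rewrite ZX.
apply/eqP; rewrite eqEsubset ZY andbT; apply/subsetP => x xY.
rewrite -[Z](Zmax (x |: Z)) ?setU11 ?subsetUr //=.
rewrite subUset sub1set xY ZY /= eqn_leq.
rewrite (rank_sub (subsetUl _ _)) andbT.
have := @rank_submod (x |: X) (X :|: Z) (X :|: (x |: Z)) X.
rewrite ZX (E x xY) leq_add2r; apply; rewrite ?subsetUl ?subsetUr //.
by apply/subsetP=> z; rewrite !inE => /or3P[] ->; rewrite ?orbT.
Qed.

Lemma rankU_closed (X Y : {set T}) :
  {in Y, forall x, r (x |: X) = r X} -> r (X :|: Y) = r X.
Proof.
move=> H; apply/eqP; rewrite eqn_leq (rank_sub (subsetUl _ _)) andbT leqNgt.
by apply/negP => /rank_ex_U1[x /H ->]; lia.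
Qed.

Lemma closure_mono (X Y : {set T}) (x : T) :
  X \subset Y -> r (x |: X) = r X -> r (x |: Y) = r Y.
Proof.
move=> XY xX; apply/eqP; rewrite eqn_leq rankU1_ge andbT.
have := @rank_submod (x |: X) Y (x |: Y) X.
rewrite xX [r X + _]addnC leq_add2r; apply; rewrite ?subsetUr // -setUA.
by rewrite (setUidPr XY).
Qed.

(** Skewness passes to subsets, so contracting [K] preserves the rank of every subset of [L]. *)
Lemma skew_sub (L K X : {set T}) :
  r (L :|: K) = r L + r K -> X \subset L -> r (X :|: K) = r X + r K.
Proof.
move=> LK XL; apply/eqP; rewrite eqn_leq rankU /=.
have := @rank_submod (X :|: K) L (L :|: K) X.
rewrite LK subsetUl XL => /(_ _ isT isT).
have -> : L :|: K \subset X :|: K :|: L by rewrite setUC -setUA subsetUr.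
by move=> /(_ isT); lia.
Qed.

Lemma contractE (K X : {set T}) : r (X :|: K) = contract r K X + r K.
Proof. by rewrite /contract subnK //; apply/rank_sub/subsetUr. Qed.

Lemma contract_matroid (K : {set T}) : is_matroid (contract r K).
Proof.
split=> [X|X Y XY|X Y].
- rewrite /contract leq_subLR addnC; apply: leq_trans (rankU _ _) _.
  by rewrite leq_add2r; case: rM.
- by apply/leq_sub2r/rank_sub/setSU.
- have := @rank_submod (X :|: K) (Y :|: K) (X :|: Y :|: K) (X :&: Y :|: K).
  rewrite !contractE => H.
  suff: contract r K (X :|: Y) + r K + (contract r K (X :&: Y) + r K) <=
    contract r K X + r K + (contract r K Y + r K) by lia.
  by apply: H; rewrite ?setSU ?subsetIl ?subsetIr // -setUUl.
Qed.

Lemma contract_contract (K K' X : {set T}) :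
  contract (contract r K) K' X = contract r (K' :|: K) X.
Proof. by rewrite /contract setUA; have := rank_sub (subsetUr K' K); lia. Qed.

(** If [X] and its complement had small rank in M/K, then [X :|: K] and its complement would have
    small rank in M. *)
Lemma contract_round (K : {set T}) : round r -> round (contract r K).
Proof.
move=> rR [X [XT XCT]]; apply: rR; exists (X :|: K); split.
  by have := contractE K X; have := contractE K setT; rewrite setTU; lia.
apply: leq_ltn_trans (_ : r (~: X :|: K) < _).
  by apply: rank_sub; rewrite setCU subIset // subsetUl.
by have := contractE K (~: X); have := contractE K setT; rewrite setTU; lia.
Qed.

Lemma simple_set_sub (S S' : {set T}) :
  simple_set r S -> S' \subset S -> simple_set r S'.
Proof. by move=> H /subsetP SS x y /SS xS /SS yS; apply: H. Qed.

Lemma simple_set_skew (L K : {set T}) :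
  r (L :|: K) = r L + r K -> simple_set r L -> simple_set (contract r K) L.
Proof.
move=> LK Ls x y xL yL; rewrite /contract (skew_sub LK) ?addnK ?Ls //.
by rewrite subUset !sub1set xL.
Qed.

Lemma simple_line_rank (L : {set T}) :
  simple_set r L -> r L <= 2 -> 1 < #|L| -> r L = 2.
Proof.
move=> Ls L2 /card_gt1P[x [y [xL yL xy]]]; apply/eqP; rewrite eqn_leq L2 /=.
have := Ls _ _ xL yL; rewrite xy => <-; apply: rank_sub.
by rewrite subUset !sub1set xL.
Qed.

End RankFunction.

Lemma short_lines_contract (T : finType) (r : {set T} -> nat) (m : nat)
  (K : {set T}) : is_matroid r -> short_lines r m -> short_lines (contract r K) m.
Proof.
move=> rM H K' S Ss; rewrite contract_contract // => S2; apply: H S2.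
by move=> x y xS yS; rewrite -contract_contract //; apply: Ss.
Qed.

(** * Projective geometries as minors *)

(* [g] represents in M/C the points of PG(n-1,F), a point being given by any of
   its nonzero coordinate vectors; the value of [g] at 0 is irrelevant. *)
Definition vector_rep (F : fieldType) (n : nat) (T : finType)
    (r : {set T} -> nat) (C : {set T}) (g : 'rV[F]_n -> T) : Prop :=
  forall s : seq 'rV[F]_n, 0%R \notin s ->
    r ([set x in map g s] :|: C) = r C + \dim <<s>>.

Lemma dim_span_map (F : fieldType) (U V : vectType F) (h : {linear U -> V})
    (s : seq U) : injective h -> \dim <<map h s>> = \dim <<s>>.
Proof.
move=> hI; have E : linfun h =1 h by move=> x; rewrite lfunE.
rewrite -(eq_map E) -limg_span limg_dim_eq //.
have /eqP-> : lker (linfun h) == 0%VS.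
  by apply/lker0P => x y; rewrite !lfunE; apply: hI.
exact: capv0.
Qed.

Lemma vector_rep_comp (F : fieldType) (m n : nat) (T : finType)
    (r : {set T} -> nat) (C : {set T}) (g : 'rV[F]_n -> T)
    (h : {linear 'rV[F]_m -> 'rV[F]_n}) :
  injective h -> vector_rep r C g -> vector_rep r C (g \o h).
Proof.
move=> hI gP s s0; rewrite map_comp gP ?dim_span_map //.
by apply: contra s0 => /mapP[x xs /esym/eqP]; rewrite raddf_eq0 // => /eqP <-.
Qed.

Lemma vector_rep_leq (F : fieldType) (m n : nat) (T : finType)
    (r : {set T} -> nat) (C : {set T}) (g : 'rV[F]_n -> T) :
  m <= n -> vector_rep r C g ->
  exists g' : 'rV[F]_m -> T, vector_rep r C g'.
Proof.
move=> mn gP; exists (g \o mulmxr (pid_mx m)); apply: vector_rep_comp gP.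
by apply: row_free_injr; rewrite /row_free rank_pid_mx.
Qed.

Lemma vector_rep_restr (F : fieldType) (n : nat) (T : finType)
    (r : {set T} -> nat) (C : {set T}) (g : 'rV[F]_n -> T) :
  is_matroid r -> r C = 0 -> vector_rep r C g -> vector_rep r set0 g.
Proof.
move=> rM C0 gP s /gP; rewrite setU0 rank0 // C0 => <-.
apply/eqP; rewrite eqn_leq rank_sub ?subsetUl //=.
by apply: leq_trans (rankU rM _ _) _; rewrite C0 addn0.
Qed.

Lemma rank_all_points (F : finFieldType) (n : nat) (T : finType)
    (r : {set T} -> nat) (C : {set T}) (g : 'rV[F]_n -> T) :
  vector_rep r C g -> r (g @: [set v : 'rV[F]_n | v != 0%R] :|: C) = r C + n.
Proof.
move=> gP.
have -> : g @: [set v : 'rV[F]_n | v != 0%R]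
        = [set x in map g (enum [set v : 'rV[F]_n | v != 0%R])].
  apply/setP=> x; rewrite inE; apply/imsetP/mapP => -[v vs ->]; exists v => //;
  by move: vs; rewrite mem_enum.
rewrite gP ?mem_enum ?inE ?eqxx //.
suff -> : <<enum [set v : 'rV[F]_n | v != 0%R]>>%VS = fullv.
  by rewrite dimvf /dim /= mul1n.
apply/eqP; rewrite eqEsubv subvf; apply/subvP => v _.
have [->|v0] := eqVneq v 0%R; first exact: mem0v.
by apply: memv_span; rewrite mem_enum inE.
Qed.

Lemma rank_points (F : fieldType) (n : nat) (T : finType)
    (r : {set T} -> nat) (g : 'rV[F]_n -> T) (s : seq 'rV[F]_n) :
  is_matroid r -> vector_rep r set0 g ->
  0%R \notin s -> r [set x in map g s] = \dim <<s>>.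
Proof. by move=> rM gP /gP; rewrite setU0 rank0. Qed.

(** Linear dependence becomes closure: adding [p] to [s] leaves the span unchanged, and closure is
    monotone. *)
Lemma points_closed (F : fieldType) (n : nat) (T : finType)
    (r : {set T} -> nat) (C X : {set T}) (g : 'rV[F]_n -> T)
    (p : 'rV[F]_n) (s : seq 'rV[F]_n) :
  is_matroid r -> vector_rep r C g ->
  p != 0%R -> 0%R \notin s -> p \in <<s>>%VS ->
  {subset map g s <= X} -> C \subset X -> r (g p |: X) = r X.
Proof.
move=> rM gP p0 s0 ps sX CX.
apply: (@closure_mono _ _ rM ([set x in map g s] :|: C)).
  by rewrite subUset CX andbT; apply/subsetP=> x; rewrite inE => /sX.
have -> : g p |: ([set x in map g s] :|: C) = [set x in map g (p :: s)] :|: C.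
  by apply/setP=> x; rewrite !inE orbA.
rewrite !gP // ?inE ?negb_or 1?eq_sym ?p0 //.
by rewrite span_cons (addv_idPr _).
Qed.

(** * Elements spanned by a projective plane *)

Lemma frame_coef0 (F : fieldType) (V : vectType F) (x y z : V) (a b c : F) :
  x != 0%R -> y \notin <[x]>%VS -> z \notin <<[:: x; y]>>%VS ->
  (a *: x + b *: y + c *: z = 0)%R -> [/\ a = 0, b = 0 & c = 0]%R.
Proof.
move=> x0 yx zxy; have [->|c0] := eqVneq c 0%R; last first.
  move=> /eqP; rewrite addrC addr_eq0 => /eqP cz; case/negP: zxy.
  have := rpredZeq <<[:: x; y]>>%VS c z; rewrite (negPf c0) /= => <-.
  by rewrite cz rpredN rpredD // memvZ // memv_span // !inE eqxx ?orbT //.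
rewrite scale0r addr0; have [->|b0] := eqVneq b 0%R; last first.
  move=> /eqP; rewrite addrC addr_eq0 => /eqP cy; case/negP: yx.
  have := rpredZeq <[x]>%VS b y; rewrite (negPf b0) /= => <-.
  by rewrite cy rpredN memvZ ?memv_line.
by rewrite scale0r addr0 => /eqP; rewrite scaler_eq0 (negPf x0) orbF => /eqP.
Qed.

(* Contracting a new point [e] of the plane yields a line with at least q^2+1
   points: [e] lies on at most one line <x,y> of the plane, so [x] and the q^2
   points off this line are pairwise nonparallel in M/e. *)
Lemma plane_closed (F : finFieldType) (T : finType) (r : {set T} -> nat)
    (g : 'rV[F]_3 -> T) (e : T) :
  is_matroid r -> vector_rep r set0 g -> short_lines r (#|F| ^ 2) ->
  r (e |: g @: [set v : 'rV[F]_3 | v != 0%R]) <= 3 ->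
  exists2 v : 'rV[F]_3, v != 0%R & r [set e; g v] <= 1.
Proof.
move=> rM gP sl e3.
have [/existsP[v /andP[v0 ev]]|] :=
  boolP [exists v : 'rV[F]_3, (v != 0%R) && (r [set e; g v] <= 1)]; first by exists v.
rewrite negb_exists => /forallP H; exfalso.
have ev (v : 'rV[F]_3) : v != 0%R -> r [set e; g v] = 2.
  move=> v0; have := H v; rewrite v0 /= -ltnNge.
  have := rankU1 rM e [set g v]; have := rank1 rM (g v); lia.
(* For independent [u] and [v], this says that [e] is on the line through [g u] and [g v]. *)
pose col u v := r [set e; g u; g v] <= 2.
(* Take [x] and [y] on the line through [e] if there is one; otherwise any independent pair will do,
   here two unit vectors. *)
have [x [y [x0 yx colP]]] : exists x y : 'rV[F]_3, [/\ x != 0%R, y \notin <[x]>%VS &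
   col x y \/ (forall u v : 'rV[F]_3, u != 0%R -> v \notin <[u]>%VS -> ~~ col u v)].
  have [/existsP[x /existsP[y /and3P[]]]|] := boolP
    [exists x : 'rV[F]_3, exists y : 'rV[F]_3,
    [&& x != 0%R, y \notin <[x]>%VS & col x y]].
    by exists x, y; split=> //; left.
  rewrite negb_exists => /forallP nc.
  exists (delta_mx 0 0)%R, (delta_mx 0 1)%R; split.
  - by apply/eqP=> /matrixP/(_ 0 0)%R/eqP; rewrite !mxE /= oner_eq0.
  - apply/vlineP=> -[k] /matrixP/(_ 0 1)%R/eqP.
    by rewrite !mxE /= mulr0 oner_eq0.
  - right=> u v u0 vu; have := nc u; rewrite negb_exists => /forallP/(_ v).
    by rewrite u0 vu.
have [z zxy] : exists z : 'rV[F]_3, z \notin <<[:: x; y]>>%VS.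
  have /subvPn[z _ zxy] : ~~ (fullv <= <<[:: x; y]>>)%VS.
    apply: contraT; rewrite negbK => /dimvS; rewrite dimvf dim_matrix.
    by move=> /leq_trans/(_ (dim_span _)).
  by exists z.
have y0 : y != 0%R by apply: contraNneq yx => ->; apply: mem0v.
have free3 a b c := @frame_coef0 _ _ x y z a b c x0 yx zxy.
(* The q^2 affine points off the line of [x] and [y], with [x] itself as the value at [None]. *)
pose gam (i : option (F * F)) : 'rV[F]_3 :=
  if i is Some ab then (ab.1 *: x + ab.2 *: y + z)%R else x.
have gam0 i : gam i != 0%R.
  case: i => [[a b]|] //=; apply/eqP => E.
  have [] := free3 a b 1%R; first by rewrite scale1r.
  by move=> _ _ /eqP; rewrite oner_eq0.
have gamI i j : i != j -> gam j \notin <[gam i]>%VS.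
  move=> ij; apply/vlineP => -[k]; case: i j ij => [[a b]|] [[a' b']|] //= ij.
  - move=> /eqP; rewrite -subr_eq0 !scalerDr !scalerA => /eqP E.
    have [] := free3 (a' - k * a)%R (b' - k * b)%R (1 - k)%R.
      by rewrite -E; apply/rowP => l; rewrite !mxE; ring.
    move=> /eqP Ea /eqP Eb /eqP; rewrite subr_eq0 => /eqP Ek.
    move: Ea Eb ij; rewrite -Ek !mul1r !subr_eq0 => /eqP-> /eqP->.
    by rewrite eqxx.
  - move=> /eqP; rewrite -subr_eq0 !scalerDr !scalerA => /eqP E.
    have [] := free3 (1 - k * a)%R (- (k * b))%R (- k)%R.
      by rewrite -E; apply/rowP => l; rewrite !mxE; ring.
    move=> /eqP Ea _ /eqP; rewrite oppr_eq0 => /eqP k0.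
    by move: Ea; rewrite k0 mul0r subr0 oner_eq0.
  - move=> /eqP; rewrite -subr_eq0 => /eqP E.
    have [] := free3 (a' - k)%R b' 1%R; last by move=> _ _ /eqP; rewrite oner_eq0.
    by rewrite -E; apply/rowP => l; rewrite !mxE; ring.
have gamC i j : i != j -> ~~ col (gam i) (gam j).
  move=> ij; have := gamI _ _ ij; have {gamI} := gamI j i; rewrite eq_sym.
  move=> /(_ ij) gji gij.
  case: colP => [cxy|]; last by apply.
  apply/negP=> cij.
  (* Two lines of a plane meet in some [p]. If [e] is on both, submodularity over the rank-2 set of
     [e] and [p] puts both lines in rank 2, although together they span [z]. *)
  have [p [p0 pij pxy]] : exists p : 'rV[F]_3, [/\ p != 0%R,
      p \in <<[:: gam i; gam j]>>%VS & p \in <<[:: x; y]>>%VS].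
    case: i j ij gij gji {cij} => [[a b]|] [[a' b']|] // ij gij gji.
    - exists (gam (Some (a, b)) - gam (Some (a', b')))%R; split.
      + by rewrite subr_eq0; apply: contraNneq gij => ->; apply: memv_line.
      + by rewrite rpredB // memv_span // !inE eqxx ?orbT.
      + have -> : (gam (Some (a, b)) - gam (Some (a', b')) =
                   (a - a') *: x + (b - b') *: y)%R.
          by apply/rowP => l; rewrite /gam /= !mxE; ring.
        by rewrite rpredD // memvZ // memv_span // !inE eqxx ?orbT.
    - by exists x; rewrite !memv_span // !inE eqxx ?orbT.
    - by exists x; rewrite !memv_span // !inE eqxx ?orbT.
  have n0 (u v : 'rV[F]_3) : u != 0%R -> v != 0%R -> 0%R \notin [:: u; v].
    by move=> u0 v0; rewrite !inE negb_or ![0%R == _]eq_sym u0.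
  pose A := g p |: [set e; g (gam i); g (gam j)].
  pose B := g p |: [set e; g x; g y].
  have A2 : r A <= 2.
    rewrite (points_closed rM gP p0 (n0 _ _ (gam0 i) (gam0 j)) pij) ?sub0set //.
    by move=> t; rewrite !inE => /orP[] ->; rewrite ?orbT.
  have B2 : r B <= 2.
    rewrite (points_closed rM gP p0 (n0 _ _ x0 y0) pxy) ?sub0set //.
    by move=> t; rewrite !inE => /orP[] ->; rewrite ?orbT.
  have s0 : 0%R \notin [:: x; y; gam i; gam j].
    by rewrite !inE !negb_or ![0%R == _]eq_sym x0 y0 !gam0.
  have := @rank_submod _ _ rM A B
            [set t in map g [:: x; y; gam i; gam j]] [set e; g p].
  rewrite (rank_points rM gP) // ev //.
  have -> : [set t in map g [:: x; y; gam i; gam j]] \subset A :|: B.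
    by apply/subsetP=> t; rewrite !inE => /or4P[] ->; rewrite ?orbT.
  have -> : [set e; g p] \subset A.
    by apply/subsetP=> t; rewrite !inE => /orP[] ->; rewrite ?orbT.
  have -> : [set e; g p] \subset B.
    by apply/subsetP=> t; rewrite !inE => /orP[] ->; rewrite ?orbT.
  move=> /(_ isT isT isT).
  suff: 3 <= \dim <<[:: x; y; gam i; gam j]>> by lia.
  have : free [:: z; y; x].
    rewrite 2!free_cons seq1_free x0 span_seq1 yx !andbT.
    by rewrite (@eq_span _ _ _ [:: x; y]) // => t; rewrite !inE orbC.
  rewrite /free /= => /eqP d3; rewrite -[leqLHS]d3.
  apply: dimvS; apply/span_subvP => t; rewrite !inE => /or3P[] /eqP ->; last 2 first.
  - by rewrite memv_span // !inE eqxx ?orbT.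
  - by rewrite memv_span // !inE eqxx ?orbT.
  have [a [b [k [ks ->]]]] : exists a b k,
      k \in [:: x; y; gam i; gam j] /\ z = (k - a *: x - b *: y)%R.
    case: i j ij gij gji {cij pij A A2 s0} => [[a b]|] [[a' b']|] // ij gij gji.
    - exists a, b, (gam (Some (a, b))); rewrite !inE eqxx ?orbT; split=> //.
      by apply/rowP => l; rewrite /gam /= !mxE; ring.
    - exists a, b, (gam (Some (a, b))); rewrite !inE eqxx ?orbT; split=> //.
      by apply/rowP => l; rewrite /gam /= !mxE; ring.
    - exists a', b', (gam (Some (a', b'))); rewrite !inE eqxx ?orbT; split=> //.
      by apply/rowP => l; rewrite /gam /= !mxE; ring.
  by rewrite !rpredB ?memvZ // memv_span // !inE ?eqxx ?orbT //; move: ks; rewrite !inE.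
have e1 : r [set e] = 1.
  by have := rank1 rM e; have := ev x x0; have := rankU rM [set e] [set g x];
     have := rank1 rM (g x); lia.
have gg0 i : g (gam i) \in g @: [set v : 'rV[F]_3 | v != 0%R].
  by apply: imset_f; rewrite inE.
have r3 i j : i != j -> r ([set g (gam i); g (gam j)] :|: [set e]) = 3.
  move=> /gamC; rewrite /col -ltnNge => h; apply/eqP; rewrite eqn_leq; apply/andP; split.
    apply: leq_trans e3; apply: rank_sub => //; rewrite setUC setUS //.
    by rewrite subUset !sub1set !gg0.
  by rewrite setUC setUA.
have gamg : injective (g \o gam).
  move=> i j /= E; apply/eqP; apply: contraT => /r3.
  rewrite E setUid; have := ev _ (gam0 j); rewrite setUC => -> //.
suff : #|[set g (gam i) | i : option (F * F)]| <= #|F| ^ 2.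
  by rewrite (card_imset _ gamg) card_option card_prod -mulnn ltnn.
apply: (sl [set e]).
  move=> _ _ /imsetP[i _ ->] /imsetP[j _ ->].
  have [->|ij] := eqVneq i j.
    by rewrite eqxx setUid /contract setUC ev // e1.
  by rewrite /contract r3 // e1 (inj_eq gamg) ij.
rewrite /contract e1 leq_subLR; apply: leq_trans e3; apply: rank_sub => //.
by rewrite setUC setUS //; apply/subsetP=> _ /imsetP[i _ ->].
Qed.

(** The products of nonzero scalars with the vectors [h x] are pairwise distinct nonzero vectors of
    [U]. *)
Lemma card_nonproportional (F : finFieldType) (n : nat) (T : finType)
    (S : {set T}) (h : T -> 'rV[F]_n) (U : {vspace 'rV[F]_n}) :
  {in S, forall x, h x \in U /\ h x != 0%R} ->
  {in S &, forall x y, x != y -> h y \notin <[h x]>%VS} ->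
  (#|F| - 1) * #|S| <= #|F| ^ \dim U - 1.
Proof.
move=> hU hS.
have -> : #|F| - 1 = #|[set c : F | c != 0%R]|.
  have := cardsC1 (0%R : F); rewrite subn1 => <-; congr #|pred_of_set _|.
  by apply/setP=> c; rewrite !inE.
rewrite -cardsX -card_vspace.
have -> : #|U| - 1 = #|[set v in U | v != 0%R]|.
  have := cardsD1 (0%R : 'rV[F]_n) [set v in U]; rewrite inE mem0v cardsE => ->.
  rewrite add1n subn1 /=; congr #|pred_of_set _|.
  by apply/setP=> v; rewrite !inE andbC.
pose phi (cx : F * T) := (cx.1 *: h cx.2)%R.
have phiI : {in setX [set c : F | c != 0%R] S &, injective phi}.
  move=> [c x] [d y]; rewrite !inE /= => /andP[c0 xS] /andP[d0 yS] /= E.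
  have xy : x = y.
    apply/eqP; apply: contraT => /(hS x y xS yS)/negP[].
    by apply/vlineP; exists (d^-1 * c)%R; rewrite -scalerA [(c *: _)%R]E scalerK.
  move/eqP: E; rewrite /phi /= xy -subr_eq0 -scalerBl scaler_eq0 subr_eq0.
  by rewrite (negPf (proj2 (hU y yS))) orbF => /eqP->.
rewrite -(card_in_imset phiI); apply/subset_leq_card/subsetP => v.
case/imsetP => -[c x]; rewrite !inE /= => /andP[c0 xS] ->.
by have [xU x0] := hU x xS; rewrite memvZ // scaler_eq0 negb_or c0.
Qed.

Lemma parallel_trans (T : finType) (r : {set T} -> nat) (a b c : T) :
  is_matroid r -> 0 < r [set b] ->
  r [set a; b] <= 1 -> r [set b; c] <= 1 -> r [set a; c] <= 1.
Proof.
move=> rM b1 ab bc; have := @rank_submod _ _ rM [set a; b] [set b; c] [set a; c] [set b].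
suff [-> -> ->] : [/\ [set a; c] \subset [set a; b] :|: [set b; c],
  [set b] \subset [set a; b] & [set b] \subset [set b; c]].
  by move=> /(_ isT isT isT); lia.
rewrite !sub1set !inE eqxx orbT; split=> //.
by apply/subsetP=> x; rewrite !inE => /orP[] ->; rewrite ?orbT.
Qed.

(** Give each [x] in [L] a coordinate vector of a point parallel to it. These vectors are pairwise
    nonproportional, and they span dimension at most [r L] because the chosen points are in the
    closure of [L]. *)
Lemma card_simple_spanned (F : finFieldType) (n : nat) (T : finType)
    (r : {set T} -> nat) (g : 'rV[F]_n -> T) (L : {set T}) :
  is_matroid r -> vector_rep r set0 g -> simple_set r L ->
  {in L, forall x, exists2 v : 'rV[F]_n, v != 0%R & r [set x; g v] <= 1} ->
  (#|F| - 1) * #|L| <= #|F| ^ r L - 1.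
Proof.
move=> rM gP Ls Lg.
pose h x : 'rV[F]_n := odflt 0%R [pick v : 'rV[F]_n | (v != 0%R) && (r [set x; g v] <= 1)].
have hP x : x \in L -> h x != 0%R /\ r [set x; g (h x)] <= 1.
  move=> /Lg[v v0 xv]; rewrite /h; case: pickP => [w /andP[]//|/(_ v)].
  by rewrite v0 xv.
have h1 x : x \in L -> r [set g (h x)] = 1.
  move=> /hP[hx0 _]; have -> : [set g (h x)] = [set y in map g [:: h x]].
    by apply/setP=> y; rewrite !inE.
  by rewrite (rank_points rM gP) ?inE 1?eq_sym // span_seq1 dim_vline hx0.
pose U := <<[seq h x | x <- enum L]>>%VS.
apply: leq_trans (_ : #|F| ^ \dim U - 1 <= _); last first.
  apply/leq_sub2r/leq_pexp2l; first by apply/card_gt0P; exists 0%R.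
  rewrite -(rank_points rM gP); last first.
    by apply/mapP=> -[x]; rewrite mem_enum => /hP[/eqP hx0 _] /esym.
  apply: leq_trans (_ : r (L :|: [set g (h x) | x in L]) <= _).
    apply: rank_sub => //; apply/subsetP => y; rewrite inE => /mapP[v /mapP[x]].
    by rewrite mem_enum => xL -> ->; rewrite inE imset_f ?orbT.
  rewrite (rankU_closed rM) // => _ /imsetP[x xL ->].
  apply: (@closure_mono _ _ rM [set x]); rewrite ?sub1set // setUC.
  have := Ls x x xL xL; rewrite setUid eqxx => x1.
  have [_] := hP x xL; have := rankU1_ge rM (g (h x)) [set x].
  by rewrite setUC x1; lia.
apply: card_nonproportional => [x xL|x y xL yL xy].
  have [hx0 _] := hP x xL; split; last exact: hx0.
  by apply: memv_span; apply/mapP; exists x; rewrite ?mem_enum.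
apply/negP => yx; have [hx0 xg] := hP x xL; have [hy0 yg] := hP y yL.
have gxy : r [set g (h x); g (h y)] <= 1.
  rewrite setUC (points_closed rM gP hy0 (s := [:: h x])) ?h1 ?inE 1?eq_sym ?sub0set //.
    by rewrite span_seq1.
  by move=> t; rewrite !inE.
have := Ls x y xL yL; rewrite xy => xy2.
have := parallel_trans rM _ xg gxy; rewrite h1 // => /(_ isT) xgy.
have := parallel_trans rM _ xgy (_ : r [set _; y] <= 1).
by rewrite h1 // setUC xy2 => /(_ isT yg).
Qed.

(** * Contracting elements away from a line *)

(** [K] is maximal among the sets that are skew to [L] and whose contraction keeps the geometry at
    rank [n]. An [x] outside the closure of [L :|: K] cannot join [K], so contracting it would lower
    that rank. *)
Lemma maximal_contraction (F : finFieldType) (n : nat) (T : finType)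
    (r : {set T} -> nat) (C L : {set T}) (g : 'rV[F]_n -> T) :
  let R := g @: [set v : 'rV[F]_n | v != 0%R] in
  is_matroid r -> vector_rep r C g ->
  exists K, [/\ r (L :|: K) = r L + r K, vector_rep (contract r K) C g,
    r (R :|: (C :|: K)) = r (C :|: K) + n &
    forall x, r (x |: (L :|: K)) = r (L :|: K) \/
      (r (x |: (R :|: (C :|: K))) = r (R :|: (C :|: K)) /\
       r (x |: (C :|: K)) != r (C :|: K))].
Proof.
move=> R rM gP.
have RC : r (R :|: C) = r C + n := rank_all_points gP.
pose P := [pred K : {set T} | (r (L :|: K) == r L + r K) &&
                              (r (R :|: (C :|: K)) == r (C :|: K) + n)].
have P0 : P set0 by rewrite /= !setU0 rank0 // addn0 RC !eqxx.
have [K /maxsetP[/andP[/eqP LK /eqP RK] Kmax] _] := maxset_exists P0.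
exists K; split=> // [s s0|x].
  have sR : [set x in map g s] \subset R.
    apply/subsetP=> y; rewrite inE => /mapP[v vs ->]; apply: imset_f.
    by rewrite inE; apply: contraNneq s0 => <-.
  rewrite /contract -setUA.
  have CK : r K <= r (C :|: K) by apply/rank_sub/subsetUr.
  suff -> : r ([set x in map g s] :|: (C :|: K)) = r (C :|: K) + \dim <<s>> by lia.
  set X := [set x in map g s] in sR *.
  have XC : r (X :|: C) = r C + \dim <<s>> by apply: gP.
  (* This inequality bounds the rank of [X] over [C :|: K] from above; [H2] bounds it from below,
     since all of [R] keeps its rank. *)
  have H1 := @rank_submod _ _ rM (X :|: C) (C :|: K) (X :|: (C :|: K)) C.
  have {H1} : r (X :|: (C :|: K)) + r C <= r (X :|: C) + r (C :|: K).
    by apply: H1; set_incl.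
  have H2 := @rank_submod _ _ rM (X :|: (C :|: K)) (R :|: C) (R :|: (C :|: K)) (X :|: C).
  have {H2} : r (R :|: (C :|: K)) + r (X :|: C) <= r (X :|: (C :|: K)) + r (R :|: C).
    by apply: H2; rewrite ?setSU //; set_incl.
  by rewrite XC RC RK; lia.
have [xLK|xLK] := eqVneq (r (x |: (L :|: K))) (r (L :|: K)); [by left|right].
have xK : r (x |: K) = (r K).+1.
  have := rankU1 rM x K; have := rankU1_ge rM x K.
  have : r (x |: K) != r K.
    by apply: contraNneq xLK => /(closure_mono rM (subsetUr L K)) ->.
  lia.
have xK' : x \notin K.
  by apply/negP=> xK'; move: xK; rewrite (setUidPr _) ?sub1set //; lia.
have nP : ~~ P (x |: K).
  apply: contra xK' => /Kmax <-; last exact: subsetUr.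
  exact: setU11.
move: nP; rewrite /= xK (setUCA L) (setUCA C) (setUCA R).
have := rankU1 rM x (L :|: K); have := rankU1_ge rM x (L :|: K).
have := rankU1 rM x (C :|: K); have := rankU1_ge rM x (C :|: K).
have := rankU1 rM x (R :|: (C :|: K)); have := rankU1_ge rM x (R :|: (C :|: K)).
have [|] := eqVneq (r (x |: (C :|: K))) (r (C :|: K)); last by lia.
move=> xCK; have := closure_mono rM (subsetUr R _) xCK; lia.
Qed.

(** After a maximal contraction every element is spanned by the line or by the plane, so by
    roundness the plane spans M/K. Then [L] consists of points parallel to those of the plane, and a
    line of these has at most q+1. *)
Lemma plane_no_long_line (F : finFieldType) (T : finType)
    (r : {set T} -> nat) (g : 'rV[F]_3 -> T) (L : {set T}) :
  is_matroid r -> round r -> short_lines r (#|F| ^ 2) ->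
  vector_rep r set0 g -> simple_set r L -> r L <= 2 -> #|L| <= #|F|.+1.
Proof.
move=> rM rR sl gP Ls L2; rewrite leqNgt; apply/negP => Llong.
have rL : r L = 2 by apply: simple_line_rank => //; lia.
have [K [LK gK RK Kmax]] := maximal_contraction L rM gP.
rewrite set0U in RK Kmax; set R := g @: _ in RK Kmax.
have KM := contract_matroid rM K.
pose X := [set x | r (x |: (L :|: K)) == r (L :|: K)].
have rX : r X <= r (L :|: K).
  rewrite -(rankU_closed rM (X := L :|: K) (Y := X)); first exact/rank_sub/subsetUr.
  by move=> x; rewrite inE => /eqP.
have rXC : r (~: X) <= r (R :|: K).
  rewrite -(rankU_closed rM (X := R :|: K) (Y := ~: X)); first exact/rank_sub/subsetUr.
  by move=> x; rewrite !inE => /eqP; case: (Kmax x) => [|[]].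
have rT : r (R :|: K) <= r setT by apply/rank_sub/subsetT.
have rT3 : r setT <= r K + 3.
  rewrite leqNgt; apply/negP => h; apply: rR; exists X; lia.
have F2 : 1 < #|F| by apply/card_gt1P; exists 0%R, 1%R; rewrite eq_sym oner_neq0.
have Lg : {in L, forall x,
    exists2 v : 'rV[F]_3, v != 0%R & contract r K [set x; g v] <= 1}.
  move=> x xL.
  apply: (@plane_closed _ _ _ _ x KM gK (short_lines_contract rM sl)).
  rewrite leq_subLR; apply: leq_trans rT3; exact/rank_sub/subsetT.
have := card_simple_spanned KM gK (simple_set_skew rM LK Ls) Lg.
have -> : contract r K L = 2 by rewrite /contract LK; lia.
move: F2 Llong; move: (#|F|) => q q2 Llong; rewrite -mulnn; nia.
Qed.

(** * Removing contracted elements *)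

(** A maximal simple subset of [S] meets each parallel class of its nonloops. *)
Lemma simple_cover (T : finType) (r : {set T} -> nat) (S : {set T}) :
  is_matroid r ->
  exists S' : {set T}, [/\ S' \subset S, simple_set r S' &
    {in S, forall x, r [set x] = 1 -> exists2 y, y \in S' & r [set x; y] <= 1}].
Proof.
move=> rM.
pose P (S' : {set T}) := (S' \subset S) &&
  [forall x in S', forall y in S', r [set x; y] == (x != y).+1].
have P0 : P set0.
  by rewrite /P sub0set; apply/'forall_implyP => x; rewrite inE.
have [S' /maxsetP[/andP[S'S S's] S'max] _] := maxset_exists P0.
have S'P : simple_set r S'.
  by move=> x y xS yS; have /'forall_implyP/(_ x xS)/'forall_implyP/(_ y yS)/eqP := S's.
exists S'; split=> // x xS x1.
have [xS'|xS'] := boolP (x \in S'); first by exists x; rewrite ?setUid ?x1.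
have [/existsP[y /andP[yS' xy]]|] := boolP [exists y, (y \in S') && (r [set x; y] <= 1)].
  by exists y.
rewrite negb_exists => /forallP H; case/negP: xS'.
have r2 y : y \in S' -> r [set x; y] = 2.
  move=> yS'; have := H y; rewrite yS' /= -ltnNge.
  have := rankU1 rM x [set y]; have := rank1 rM y; lia.
have nx y : y \in S' -> x != y.
  by move=> yS'; apply/eqP=> xy; have := r2 y yS'; rewrite -xy setUid x1.
rewrite -(S'max (x |: S')) ?setU11 ?subsetUr // /P subUset sub1set xS S'S /=.
apply/'forall_implyP => y; rewrite in_setU1 => yS.
apply/'forall_implyP => z; rewrite in_setU1 => zS; apply/eqP.
case/predU1P: yS => [->|yS]; case/predU1P: zS => [->|zS].
- by rewrite eqxx setUid x1.
- by rewrite r2 // nx.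
- by rewrite setUC r2 // eq_sym nx.
- exact: S'P.
Qed.

(** * Combinatorial lines as affine subspaces *)

Section WordVectors.

Variables (F : finFieldType) (N m : nat).
Local Open Scope ring_scope.

(** The leading 1 makes the flattened word an affine point, off the hyperplane at infinity
    [hyperplane0]. *)
Definition word_vec (w : seq 'rV[F]_m) : 'rV[F]_(1 + N * m) :=
  row_mx (const_mx 1) (mxvec (\matrix_(i < N) nth 0 w i)).

Definition hyperplane0 : {vspace 'rV[F]_(1 + N * m)} :=
  lker (linfun (@lsubmx F 1 1 (N * m))).

Variable t : seq (option 'rV[F]_m).
Hypotheses (sz_t : size t = N) (t_var : None \in t).

Let S : 'cV[F]_N := \col_(i < N) (nth (Some 0) t i == None)%:R.

(** This copies a vector into every moving coordinate of [t] and puts 0 elsewhere. As letters are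
    vectors, the line of [t] is an affine subspace with these directions. *)
Definition line_dir : {linear 'rV[F]_m -> 'rV[F]_(1 + N * m)} :=
  (mulmxr (row_mx 0 1%:M : 'M_(N * m, 1 + N * m)) \o (mxvec \o mulmx S))%FUN.

Lemma mem_hyperplane0 (v : 'rV[F]_(1 + N * m)) : (v \in hyperplane0) = (lsubmx v == 0).
Proof. by rewrite memv_ker lfunE. Qed.

Lemma word_vec_notin w : word_vec w \notin hyperplane0.
Proof.
rewrite mem_hyperplane0 row_mxKl; apply/eqP => /matrixP/(_ 0 0)/eqP.
by rewrite !mxE oner_eq0.
Qed.

Lemma line_dirE v : line_dir v = row_mx 0 (mxvec (S *m v)).
Proof. by rewrite /= mul_mx_row mulmx0 mulmx1. Qed.

Lemma line_dir_hyperplane0 v : line_dir v \in hyperplane0.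
Proof. by rewrite mem_hyperplane0 line_dirE row_mxKl. Qed.

Lemma line_dir_inj : injective line_dir.
Proof.
have [i0 tN] : exists i : 'I_N, nth (Some 0) t i = None.
  have := t_var; rewrite -index_mem sz_t => iN.
  by exists (Ordinal iN); rewrite /= nth_index.
move=> u v; rewrite !line_dirE => /eq_row_mx[_ /(can_inj mxvecK) E].
have H (w : 'rV[F]_m) : row i0 (S *m w) = w.
  by apply/rowP => j; rewrite !mxE big_ord1 !mxE tN eqxx mul1r.
by rewrite -(H u) E H.
Qed.

Lemma word_vec_inst (u v : 'rV[F]_m) :
  word_vec (inst t (u + v)) = word_vec (inst t u) + line_dir v.
Proof.
rewrite line_dirE /word_vec add_row_mx addr0 -linearD; congr (row_mx _ (mxvec _)).
apply/matrixP => i j; rewrite !mxE big_ord1 !mxE.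
rewrite !(nth_map (Some 0)) ?sz_t //.
by case: (nth _ t i) => [x|] /=; rewrite ?mul0r ?addr0 ?mxE ?mul1r.
Qed.

(** The base point is off the hyperplane at infinity and the directions are in it, so the span is a
    direct sum of a 1-space and a copy of [<<s>>]. *)
Lemma dim_word_vec (v0 : 'rV[F]_m) (s : seq 'rV[F]_m) :
  \dim <<[seq word_vec (inst t u) | u <- v0 :: [seq (v0 + u)%R | u <- s]]>>
    = (\dim <<s>>).+1.
Proof.
have -> : <<[seq word_vec (inst t u) | u <- v0 :: [seq (v0 + u)%R | u <- s]]>>%VS
        = <<word_vec (inst t v0) :: map line_dir s>>%VS.
  rewrite /= -map_comp; apply/eqP; rewrite eqEsubv; apply/andP; split;
    apply/span_subvP => x; rewrite inE => /predU1P[->|/mapP[u us ->]];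
    try by rewrite memv_span ?mem_head.
  - rewrite [comp _ _ _]word_vec_inst rpredD ?memv_span ?mem_head // inE.
    by rewrite map_f ?orbT.
  - have -> : line_dir u = word_vec (inst t (v0 + u)) - word_vec (inst t v0).
      by rewrite word_vec_inst addrC addKr.
    rewrite rpredB ?memv_span ?mem_head // inE; apply/orP; right.
    by apply/mapP; exists u.
rewrite span_cons dimv_disjoint_sum; last first.
  apply/eqP; rewrite -subv0; apply/subvP => x; rewrite memv_cap memv0 => /andP[].
  case/vlineP=> k -> kx; have [->|k0] := eqVneq k 0; first by rewrite scale0r.
  case/negP: (word_vec_notin (inst t v0)).
  have := rpredZeq hyperplane0 k (word_vec (inst t v0)); rewrite (negPf k0) /= => <-.
  apply: subvP kx; apply/span_subvP => _ /mapP[u _ ->].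
  exact: line_dir_hyperplane0.
rewrite dim_span_map ?dim_vline; last exact: line_dir_inj.
suff -> : word_vec (inst t v0) != 0 by [].
by apply: contraNneq (word_vec_notin (inst t v0)) => ->; apply: mem0v.
Qed.

End WordVectors.

(* With [D] the union of [C] and a basis of the hyperplane at infinity, M/D has
   rank 2 on [e] and the points of the affine part, and [chi w] is the parallel
   class in M/D of the affine point [w]. *)
Lemma affine_colouring (F : finFieldType) (N m : nat) (T : finType)
    (r : {set T} -> nat) (C : {set T}) (e : T)
    (g : 'rV[F]_(1 + N * m) -> T) :
  is_matroid r -> short_lines r (#|F| ^ 2) -> r (e |: C) = (r C).+1 ->
  vector_rep r (e |: C) g ->
  exists (D : {set T}) (chi : seq 'rV[F]_m -> 'I_(#|F| ^ 2).+1),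
    C \subset D /\
    forall ws : pred (seq 'rV[F]_m),
      (forall w w', ws w -> ws w' -> chi w = chi w') ->
      forall Z : {set T}, {in Z, forall z, exists2 w, ws w & z = g (word_vec N w)} ->
      r (e |: (Z :|: D)) = (r (Z :|: D)).+1.
Proof.
move=> rM sl eC gP.
pose W := hyperplane0 F N m; pose B : seq 'rV[F]_(1 + N * m) := vbasis W.
have BW : <<B>>%VS = W by apply: span_basis; apply: vbasisP.
have B0 : 0%R \notin B.
  by apply/negP => /(free_not0 (basis_free (vbasisP W))); rewrite eqxx.
pose D := [set x in map g B] :|: C.
have eDE : e |: D = [set x in map g B] :|: (e |: C) by rewrite setUCA.
have reD : r (e |: D) = (r C).+1 + \dim W by rewrite eDE gP // eC BW.
(* The size of the basis bounds the rank from above; the bound from below holds because [e] adds at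
   most 1. *)
have rD : r D = r C + \dim W.
  have := rankU1 rM e D; rewrite reD.
  suff : r D <= r C + \dim W by lia.
  apply: leq_trans (rankU rM _ _) _; rewrite addnC leq_add2l.
  case: rM => h _ _; apply: leq_trans (h _) _; rewrite cardsE.
  by apply: leq_trans (card_size _) _; rewrite size_map size_tuple.
have CD : C \subset D by apply: subsetUr.
have DM := contract_matroid rM D.
pose A := [set u : 'rV[F]_(1 + N * m) | lsubmx u == const_mx 1%R].
have AW (u : 'rV[F]_(1 + N * m)) : u \in A -> u \notin W.
  rewrite inE mem_hyperplane0 => /eqP ->; apply/eqP => /matrixP/(_ 0 0)%R/eqP.
  by rewrite !mxE oner_eq0.
have A0 (u : 'rV[F]_(1 + N * m)) : u \in A -> u != 0%R.
  by move=> /AW; apply: contraNneq => ->; apply: mem0v.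
have Aw w : word_vec N w \in A by rewrite inE row_mxKl.
have AB (u : 'rV[F]_(1 + N * m)) : u \in A -> 0%R \notin u :: B.
  by move=> /A0 u0; rewrite inE negb_or eq_sym u0.
have guD (u : 'rV[F]_(1 + N * m)) : u \in A -> r (g u |: (e |: D)) = (r D).+2.
  move=> uA; have -> : g u |: (e |: D) = [set x in map g (u :: B)] :|: (e |: C).
    by rewrite eDE setUA; congr (_ :|: _); apply/setP=> x; rewrite !inE.
  rewrite gP ?AB // span_cons dimv_disjoint_sum; last first.
    apply/eqP; rewrite -subv0; apply/subvP => x; rewrite memv_cap memv0 => /andP[].
    case/vlineP=> k ->; rewrite BW => kx.
    have [->|k0] := eqVneq k 0%R; first by rewrite scale0r.
    case/negP: (AW u uA).
    by have := rpredZeq W k u; rewrite (negPf k0) /= => <-.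
  by rewrite dim_vline A0 //= BW eC rD add1n addnS addSn.
have gu1 (u : 'rV[F]_(1 + N * m)) : u \in A -> r (g u |: D) = (r D).+1.
  move=> uA; have := rankU1 rM (g u) D; have := rankU1 rM e (g u |: D).
  by rewrite (setUCA [set e]) guD //; lia.
pose cr := contract r D.
have cgu (u : 'rV[F]_(1 + N * m)) : u \in A -> cr [set g u] = 1.
  by move=> uA; rewrite /cr /contract gu1 //; lia.
have ce : cr [set e] = 1 by rewrite /cr /contract reD rD; lia.
have ceu (u : 'rV[F]_(1 + N * m)) : u \in A -> cr [set e; g u] = 2.
  by move=> uA; rewrite /cr /contract -setUA (setUCA [set e]) guD //; lia.
have [K [KA Ks Kc]] := simple_cover (g @: A) DM.
(* In M/D the element [e] is parallel to no affine point, so [e |: K] is a simple set of rank at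
   most 2. *)
have Kq : #|K| <= #|F| ^ 2.
  have eK : e \notin K.
    apply/negP=> /(subsetP KA)/imsetP[u uA eu].
    by have := ceu u uA; rewrite -eu setUid ce.
  suff : #|e |: K| <= #|F| ^ 2 by rewrite cardsU1 eK; lia.
  apply: (sl D).
    have cK y : y \in K -> cr [set e; y] = 2.
      by move=> /(subsetP KA)/imsetP[u uA ->]; exact: ceu.
    move=> x y; rewrite !inE => /predU1P[->|xK] /predU1P[->|yK].
    - by rewrite setUid eqxx.
    - rewrite [contract _ _ _]cK //; suff -> : e != y by [].
      by apply: contraNneq eK => ->.
    - rewrite setUC [contract _ _ _]cK //; suff -> : x != e by [].
      by apply: contraNneq eK => <-.
    - exact: Ks.
  have [->|[y yK]] := set_0Vmem K; first by rewrite setU0 [contract _ _ _]ce.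
  have [u0 u0A yE] : exists2 u0, u0 \in A & y = g u0.
    by have /imsetP[u0] := subsetP KA y yK; exists u0.
  rewrite /contract leq_subLR.
  apply: leq_trans (_ : r (g u0 |: (e |: D) :|: K) <= _).
    by apply: rank_sub => //; set_incl.
  rewrite (rankU_closed rM) ?guD ?addn2 // => z /(subsetP KA)/imsetP[u uA ->].
  rewrite -(guD u0 u0A).
  apply: (points_closed (s := u0 :: B) rM gP (A0 u uA) (AB u0 u0A)).
  (* Affine points differ by vectors at infinity, so [u0] and the basis [B] span them all. *)
  - have -> : u = (u0 + (u - u0))%R by rewrite addrC subrK.
    rewrite span_cons memv_add ?memv_line // BW mem_hyperplane0 raddfB /=.
    by move: uA u0A; rewrite !inE => /eqP-> /eqP->; rewrite subrr.
  - move=> x; rewrite !inE => /predU1P[->|->]; rewrite ?eqxx ?orbT //.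
  - by rewrite subsetU // setUS ?orbT.
pose kap w := odflt e [pick y in K | cr [set g (word_vec N w); y] <= 1].
have kapP w : kap w \in K /\ cr [set g (word_vec N w); kap w] <= 1.
  rewrite /kap; case: pickP => [y /andP[]//|].
  have [|y yK yc] := Kc _ (imset_f g (Aw w)); first exact: cgu.
  by move=> /(_ y); rewrite yK yc.
(* The index is below [#|K|], hence at most q^2, so [inord] does not merge classes. *)
exists D, (fun w => inord (index (kap w) (enum K))); split=> // ws wsc Z ZP.
apply/eqP; rewrite eqn_leq rankU1 //= ltnNge; apply/negP => eZ.
have {}eZ : r (e |: (Z :|: D)) = r (Z :|: D).
  by apply/eqP; rewrite eqn_leq eZ rankU1_ge.
have [Z0|[z0 z0Z]] := set_0Vmem Z.
  by move: eZ; rewrite Z0 set0U reD rD; lia.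
have [w0 w0s _] := ZP z0 z0Z; pose y := kap w0.
have kE w : ws w -> kap w = y.
  move=> sw; have /(congr1 val) := wsc _ _ sw w0s.
  have kK w' : kap w' \in enum K by have [] := kapP w'; rewrite mem_enum.
  have ki w' : index (kap w') (enum K) < (#|F| ^ 2).+1.
    by rewrite ltnS; apply: leq_trans Kq; rewrite cardE ltnW // index_mem.
  by rewrite /= !inordK // => E; rewrite -[LHS](nth_index e (kK w)) E nth_index.
have [u uA yE] : exists2 u, u \in A & y = g u.
  by have [kK _] := kapP w0; have /imsetP[u] := subsetP KA _ kK; exists u.
(* Having one colour, [Z] is in the closure of [y |: D]; but [e] is not, since [y] is an affine
   point. *)
have yZ : r (y |: D :|: Z) = r (y |: D).
  apply: (rankU_closed rM) => z /ZP[w sw ->].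
  have [_] := kapP w; rewrite kE // /cr /contract -setUA.
  have := rankU1_ge rM (g (word_vec N w)) (y |: D); rewrite yE gu1 //; lia.
have ZDy : Z :|: D \subset y |: D :|: Z by set_incl.
have := closure_mono rM ZDy eZ.
have : y |: (e |: D) \subset e |: (y |: D :|: Z) by set_incl.
move=> /(rank_sub rM); rewrite yZ yE guD // gu1 //; lia.
Qed.

(** A monochromatic combinatorial line is an affine subspace whose span over [C] avoids [e], so [e]
    may be left out of the contracted set. Contracting instead one of its points [a] leaves its
    m-dimensional space of directions as the new geometry. *)
Lemma point_contraction (q m : nat) : 1 < m ->
  exists2 N, 0 < N & forall (F : finFieldType) (T : finType)
    (r : {set T} -> nat) (C L : {set T}) (e : T) (g : 'rV[F]_(1 + N * m) -> T),
    #|F| = q -> is_matroid r -> short_lines r (q ^ 2) ->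
    r (e |: C) = (r C).+1 -> vector_rep r (e |: C) g ->
    r (L :|: C) <= r C + 2 ->
    exists (a : T) (g' : 'rV[F]_m -> T),
      r (a |: (L :|: C)) = (r (L :|: C)).+1 /\ vector_rep r (a |: C) g'.
Proof.
move=> m1; have [N HN] := hales_jewett (q ^ m) (q ^ 2).+1.
exists N.
  (* A variable word contains [None], so its length [N] is positive. *)
  have := HN 'I_(q ^ m) 'I_(q ^ 2).+1 (fun=> ord0); rewrite !card_ord.
  by move=> /(_ erefl erefl)[[|o t] [<- []]].
move=> F T r C L e g Fq rM sl eC gP LC; rewrite -{}Fq in sl HN.
have [D [chi [CD chiP]]] := affine_colouring rM sl eC gP.
have [||t [tN [tv tm]]] := HN _ _ chi; first by rewrite card_mx mul1n.
  by rewrite card_ord.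
pose ws := [pred w | [exists v, w == inst t v]].
pose psi v := word_vec N (inst t v).
have eZ (s : seq 'rV[F]_m) :
    r ([set x in map g (map psi s)] :|: C) = r C + \dim <<map psi s>>.
  set X := [set x in _].
  have eX : r (e |: (X :|: C)) = r C + 1 + \dim <<map psi s>>.
    rewrite setUCA gP ?eC ?addn1 //; apply/mapP=> -[v _ /esym/eqP].
    apply/negP; apply: contraNneq (word_vec_notin N (inst t v)).
    by rewrite -/(psi v) => ->; apply: mem0v.
  have := rankU1 rM e (X :|: C); have := rankU1_ge rM e (X :|: C).
  (* Were [e] in the closure of [X :|: C], it would be in that of [X :|: D], against the choice of
     the colouring. *)
  have [|] := eqVneq (r (e |: (X :|: C))) (r (X :|: C)); last by lia.
  move=> /(closure_mono rM (setUS X CD)).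
  rewrite (chiP ws); first by lia.
  - move=> w w' /existsP[v /eqP->] /existsP[v' /eqP->].
    by apply: tm; rewrite mem_enum.
  - move=> z; rewrite inE -map_comp => /mapP[v _ ->].
    by exists (inst t v) => //; apply/existsP; exists v.
have dpsi v0 s : r ([set x in map g (map psi (v0 :: [seq (v0 + u)%R | u <- s]))] :|: C)
    = (r C + \dim <<s>>).+1.
  by rewrite eZ (dim_word_vec tN tv) addnS.
(* Over [C] the affine subspace has rank m+1, which exceeds 2, so one of its points escapes the
   closure of [L :|: C]. *)
have [|a] := @rank_ex_U1 _ _ rM (L :|: C) [set g (psi v) | v : 'rV[F]_m].
  apply: leq_ltn_trans LC _.
  apply: leq_trans (_ : (r C + \dim <<enum 'rV[F]_m>>).+1 <= _).
    rewrite ltnS leq_add2l.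
    suff -> : <<enum 'rV[F]_m>>%VS = fullv by rewrite dimvf dim_matrix mul1r.
    by apply/eqP; rewrite eqEsubv subvf; apply/subvP => v _; rewrite memv_span ?mem_enum.
  rewrite -(dpsi 0%R); apply: rank_sub => //.
  rewrite subUset; apply/andP; split; last by set_incl.
  apply/subsetP=> x; rewrite inE -map_comp => /mapP[v _ ->].
  by rewrite inE imset_f ?orbT.
case/imsetP => v0 _ -> aLC; exists (g (psi v0)), (fun u => g (psi (v0 + u)%R)).
split=> // s s0.
have E s' : [set x in [seq g (psi (v0 + u)%R) | u <- s']] :|: (g (psi v0) |: C) =
   [set x in map g (map psi (v0 :: [seq (v0 + u)%R | u <- s']))] :|: C.
  by rewrite /= -!map_comp; apply/setP=> x; rewrite !inE orbCA orbA.
rewrite E dpsi; suff -> : r (g (psi v0) |: C) = (r C).+1 by rewrite addSn.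
have := E [::]; rewrite set_nil set0U => ->.
by rewrite dpsi span_nil dimv0 addn0.
Qed.

(** Induction on [k]: [C] is replaced by a subset [e |: C'] of the same rank, and
    [point_contraction] trades [e] for a point [a]. In M/a the set [C'] has rank at most [k], and
    [L] is still a simple line since [a] is outside its closure. *)
Lemma no_long_line_rank (q k : nat) :
  exists2 n, 3 <= n & forall (F : finFieldType) (T : finType)
    (r : {set T} -> nat) (C L : {set T}) (g : 'rV[F]_n -> T),
    #|F| = q -> is_matroid r -> round r -> short_lines r (q ^ 2) ->
    vector_rep r C g -> r C <= k -> simple_set r L -> r L <= 2 -> #|L| <= q.+1.
Proof.
elim: k => [|k [m m3 IH]].
  exists 3 => // F T r C L g <- rM rR sl gP C0; apply: plane_no_long_line rR sl _ => //.
  by apply: vector_rep_restr gP => //; lia.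
have [N N0 HN] := point_contraction q (ltnW m3).
have mN : m <= 1 + N * m by rewrite -[leqLHS]mul1n leqW // leq_mul.
exists (1 + N * m) => [|F T r C L g Fq rM rR sl gP Ck Ls L2].
  exact: leq_trans mN.
have [Ck'|kC] := leqP (r C) k.
  by have [g' g'P] := vector_rep_leq mN gP; apply: IH g'P Ck' Ls L2.
have P0 : (set0 \subset C) && (r set0 <= k) by rewrite sub0set rank0.
have [C' /maxsetP[/andP[C'C C'k] C'max] _] :=
  @maxset_exists _ [pred X : {set T} | (X \subset C) && (r X <= k)] _ P0.
have [e eC eC'] : exists2 e, e \in C & r (e |: C') = (r C').+1.
  by apply: rank_ex_U1 => //; rewrite (setUidPr C'C); lia.
have rC' : r C' = k.
  apply/eqP; rewrite eqn_leq C'k leqNgt; apply/negP => h.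
  have := C'max (e |: C'); rewrite /= subUset sub1set eC C'C eC' h subsetUr.
  by move=> /(_ isT isT) E; have := eC'; rewrite E; lia.
have eCC : e |: C' \subset C by rewrite subUset sub1set eC.
(* As [e |: C'] spans [C], contracting either set gives the same ranks. *)
have {}gP : vector_rep r (e |: C') g.
  have reC : r (e |: C') = r C by lia.
  move=> s /gP; rewrite reC => <-; apply/eqP; rewrite eqn_leq.
  rewrite (rank_sub rM (setUS _ eCC)) /=.
  have := @rank_submod _ _ rM ([set x in map g s] :|: (e |: C')) C
            ([set x in map g s] :|: C) (e |: C').
  rewrite reC leq_add2r; apply; rewrite ?subsetUr //.
  by rewrite -setUA setUS // subsetUr.
have LC' : r (L :|: C') <= r C' + 2 by have := rankU rM L C'; lia.
have [a [g' [aL g'P]]] := HN _ _ _ _ L _ _ Fq rM sl eC' gP LC'.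
have aLs : r (a |: L) = (r L).+1.
  have := rankU1 rM a L; have := rankU1_ge rM a L.
  have [|] := eqVneq (r (a |: L)) (r L); last by lia.
  by move=> /(closure_mono rM (subsetUl L C')); lia.
have a1 : r [set a] = 1 by have := rank1 rM a; have := rankU rM [set a] L; lia.
have aL' : r (L :|: [set a]) = r L + r [set a] by rewrite setUC; lia.
apply: (IH F T (contract r [set a]) C' L g' Fq).
- exact: contract_matroid.
- exact: contract_round.
- exact: short_lines_contract.
- move=> s s0; rewrite /contract -setUA (setUC C') g'P //.
  by have := rankU1_ge rM a C'; have := rank_sub rM (subsetUl [set a] C'); lia.
- by rewrite /contract; have := rankU rM C' [set a]; lia.
- exact: simple_set_skew.
- by rewrite /contract aL'; lia.
Qed.

(** After a maximal contraction, [C] is in the closure of [L :|: K]: its elements cannot raise the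
    rank of [C :|: K]. So [C] has rank at most 2 in M/K. *)
Lemma no_long_line (q : nat) :
  exists2 n, 3 <= n & forall (F : finFieldType) (T : finType)
    (r : {set T} -> nat) (C L : {set T}) (g : 'rV[F]_n -> T),
    #|F| = q -> is_matroid r -> round r -> short_lines r (q ^ 2) ->
    vector_rep r C g -> simple_set r L -> r L <= 2 -> #|L| <= q.+1.
Proof.
have [n n3 Hn] := no_long_line_rank q 2; exists n => // F T r C L g Fq rM rR sl gP Ls L2.
have [K [LK gK _ Kmax]] := maximal_contraction L rM gP.
apply: (Hn F T (contract r K) C L g Fq) => //.
- exact: contract_matroid.
- exact: contract_round.
- exact: short_lines_contract.
- have LKC : r (L :|: K :|: C) = r (L :|: K).
    apply: (rankU_closed rM) => x xC; case: (Kmax x) => // -[_].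
    by rewrite setUA (setUidPr (_ : [set x] \subset C)) ?eqxx ?sub1set.
  have : r (C :|: K) <= r (L :|: K :|: C) by apply: rank_sub => //; set_incl.
  by rewrite /contract; lia.
- exact: simple_set_skew.
- by rewrite /contract LK; lia.
Qed.

(** * Counting points *)

(** At most one element of [S] is parallel to [x]. Those in one parallel class of M/x form with [x]
    a line, so there are at most [q] of them. *)
Lemma card_simple_contract (T : finType) (r : {set T} -> nat) (q : nat) (x : T)
    (S : {set T}) :
  is_matroid r -> r [set x] = 1 ->
  (forall L, simple_set r L -> r L <= 2 -> #|L| <= q.+1) -> simple_set r S ->
  exists2 S', simple_set (contract r [set x]) S' & #|S| <= 1 + #|S'| * q.
Proof.
move=> rM x1 Hq Ss.
have [S' [S'S S's S'c]] := simple_cover S (contract_matroid rM [set x]).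
exists S' => //.
pose A0 := [set s in S | r [set s; x] <= 1].
pose A y := [set s in S | (1 < r [set s; x]) && (r [set s; y; x] <= 2)].
have SA : S \subset A0 :|: \bigcup_(y in S') A y.
  apply/subsetP => s sS; rewrite !inE sS /=; case: leqP => //= sx.
  have [|y yS'] := S'c s sS.
    by rewrite /contract x1; have := rankU rM [set s] [set x]; have := rank1 rM s; lia.
  rewrite /contract x1 => sy; apply/bigcupP; exists y => //.
  by rewrite inE sS sx; lia.
have A0P : #|A0| <= 1.
  apply/card_le1_eqP => s t; rewrite !inE => /andP[sS sx] /andP[tS tx].
  apply/esym/eqP; apply: contraT => st; have := Ss s t sS tS; rewrite st.
  have := @parallel_trans _ r s x t rM; rewrite x1 => /(_ isT sx).
  by rewrite setUC tx => /(_ isT); lia.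
have AP y : y \in S' -> #|A y| <= q.
  move=> yS'; rewrite -ltnS.
  have xA : x \notin A y by rewrite inE setUid x1 andbF.
  have -> : #|A y|.+1 = #|x |: A y| by rewrite cardsU1 xA.
  have sx2 s : 1 < r [set s; x] -> r [set s; x] = 2.
    by have := rankU rM [set s] [set x]; have := rank1 rM s; lia.
  apply: Hq.
    move=> s t; rewrite !in_setU1 => /predU1P[->|sA] /predU1P[->|tA].
    - by rewrite setUid x1 eqxx.
    - have -> : x != t by apply: contraNneq xA => ->.
      by move: tA; rewrite setUC inE => /and3P[_ /sx2-> _].
    - have -> : s != x by apply: contraNneq xA => <-.
      by move: sA; rewrite inE => /and3P[_ /sx2-> _].
    - by move: sA tA; rewrite !inE => /andP[sS _] /andP[tS _]; apply: Ss.
  have yx2 : r [set y; x] = 2.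
    have := S's y y yS' yS'; rewrite eqxx setUid /contract x1; lia.
  rewrite -yx2; apply: leq_trans (_ : r ([set y; x] :|: A y) <= _).
    by apply: rank_sub => //; rewrite subUset subsetUr sub1set !inE eqxx orbT.
  rewrite (rankU_closed rM) // => s; rewrite inE => /and3P[sS sx sy].
  have := rankU1_ge rM s [set y; x]; rewrite setUA; lia.
apply: leq_trans (subset_leq_card SA) _; apply: leq_trans (leq_card_setU _ _) _.
apply: leq_add => //; rewrite -sum_nat_const.
apply: leq_trans (_ : \sum_(y in S') #|A y| <= _); last exact: leq_sum.
elim/big_rec2: _ => [|y B n _ h]; first by rewrite cards0.
by apply: leq_trans (leq_card_setU _ _) _; rewrite leq_add2l.
Qed.

Lemma card_points_step (q R s s' : nat) : 1 < q ->
  s <= 1 + s' * q -> (q - 1) * s' <= q ^ R - 1 -> (q - 1) * s <= q ^ R.+1 - 1.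
Proof.
move=> q1 ss'; have q0 : 0 < q ^ R by rewrite expn_gt0; lia.
rewrite expnS; move: (q ^ R) q0 => Q Q0; nia.
Qed.

(** Induction on the rank. In rank 3 every element is parallel to a point of the plane; in higher
    rank an [x] outside the closure of the plane is contracted, which leaves the plane intact. *)
Lemma card_simple_plane (F : finFieldType) (T : finType) (S : {set T})
    (r : {set T} -> nat) (g : 'rV[F]_3 -> T) :
  is_matroid r -> round r -> short_lines r (#|F| ^ 2) -> vector_rep r set0 g ->
  simple_set r S -> (#|F| - 1) * #|S| <= #|F| ^ r setT - 1.
Proof.
move=> rM rR sl gP.
have F2 : 1 < #|F| by apply/card_gt1P; exists 0%R, 1%R; rewrite eq_sym oner_neq0.
elim: {r}(r setT) {-2}r (leqnn (r setT)) S rM rR sl gP => [|d IH] r rTd S rM rR sl gP Ss.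
  have := rank_all_points gP.
  have := rank_sub rM (subsetT (g @: [set v : 'rV[F]_3 | v != 0%R])).
  by rewrite setU0 rank0 //; lia.
have R3 := rank_all_points gP; rewrite setU0 rank0 // in R3.
set R := g @: _ in R3.
have [rT3|rT3] := leqP (r setT) 3.
  apply: leq_trans (_ : #|F| ^ r S - 1 <= _).
    apply: (card_simple_spanned rM gP Ss) => x xS.
    apply: (@plane_closed _ _ _ _ x rM gP sl).
    by apply: leq_trans rT3; apply/rank_sub/subsetT.
  by apply/leq_sub2r/leq_pexp2l; [lia|apply/rank_sub/subsetT].
have [|x _ xR] := @rank_ex_U1 _ _ rM R setT; first by rewrite setUT; lia.
have x1 : r [set x] = 1 by have := rank1 rM x; have := rankU rM [set x] R; lia.
have [S' S's SS'] :=
  card_simple_contract rM x1 (fun L => plane_no_long_line rM rR sl gP) Ss.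
have rT1 : contract r [set x] setT = (r setT).-1 by rewrite /contract setTU x1 subn1.
have -> : r setT = (contract r [set x] setT).+1 by lia.
apply: card_points_step SS' _ => //; apply: IH => //.
- by rewrite rT1; lia.
- exact: contract_matroid.
- exact: contract_round.
- exact: short_lines_contract.
move=> s s0; rewrite setU0 rank0; last exact: contract_matroid.
rewrite /contract (@skew_sub _ _ rM R) ?(rank_points rM gP) ?addnK //.
  by rewrite setUC; lia.
apply/subsetP=> y; rewrite inE => /mapP[v vs ->]; apply: imset_f.
by rewrite inE; apply: contraNneq s0 => <-.
Qed.

(** Induction on the rank of [C]: contracting a nonloop [x] of [C] lowers this rank and leaves M/C
    unchanged up to the loop [x]. At rank 0 the geometry is a restriction, and it contains a
    plane. *)
Lemma card_simple_minor (q : nat) :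
  exists2 n, 3 <= n & forall (F : finFieldType) (T : finType)
    (r : {set T} -> nat) (C S : {set T}) (g : 'rV[F]_n -> T),
    #|F| = q -> is_matroid r -> round r -> short_lines r (q ^ 2) ->
    vector_rep r C g -> simple_set r S -> (q - 1) * #|S| <= q ^ r setT - 1.
Proof.
have [n n3 Hn] := no_long_line q; exists n => // F T r C S g Fq.
elim: {r}(r C).+1 {-2}r (ltnSn (r C)) S => // d IH r rCd S rM rR sl gP Ss.
have [C0|C0] := posnP (r C).
  have [g' g'P] := vector_rep_leq n3 (vector_rep_restr rM C0 gP).
  by rewrite -Fq in sl *; apply: card_simple_plane g'P Ss.
have [|x xC] := @rank_ex_U1 _ _ rM set0 C; first by rewrite set0U rank0.
rewrite setU0 rank0 // => x1.
have [S' S's SS'] := card_simple_contract rM x1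
  (fun L => Hn F T r C L g Fq rM rR sl gP) Ss.
have rT0 : r C <= r setT by apply/rank_sub/subsetT.
have rT1 : contract r [set x] setT = (r setT).-1 by rewrite /contract setTU x1 subn1.
have -> : r setT = (contract r [set x] setT).+1 by lia.
have Cx X : (X :|: C) :|: [set x] = X :|: C.
  by apply/setUidPl; rewrite sub1set inE xC orbT.
apply: card_points_step SS' _.
  by rewrite -Fq; apply/card_gt1P; exists 0%R, 1%R; rewrite eq_sym oner_neq0.
have Cx0 := Cx set0; rewrite set0U in Cx0.
apply: IH => //.
- by rewrite /contract Cx0; lia.
- exact: contract_matroid.
- exact: contract_round.
- exact: short_lines_contract.
by move=> s s0; rewrite /contract Cx Cx0 gP //; lia.
Qed.

(** * Passing from points and minors to simple sets and vectors *)

(** One nonloop is picked from each rank-1 flat; nonloops that are parallel lie in the same flat. *)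
Lemma num_points_simple (T : finType) (r : {set T} -> nat) :
  is_matroid r -> exists2 S, simple_set r S & #|S| = num_points r.
Proof.
move=> rM; rewrite /num_points; set Ps := [set X | _].
pose h (P : {set T}) := [pick x in P | r [set x] == 1].
have flatP P x y : P \in Ps -> x \in P -> r [set x] = 1 -> r [set x; y] <= 1 -> y \in P.
  rewrite inE => /andP[/forallP/(_ y) fP /eqP P1] xP x1 xy.
  move: fP; case: (boolP (y \in P)) => //= _.
  rewrite (@closure_mono _ _ rM [set x]) ?ltnn ?sub1set //.
  by have := rankU1_ge rM y [set x]; rewrite setUC; lia.
have subPQ P Q x y : P \in Ps -> Q \in Ps -> x \in P -> y \in Q ->
    r [set x] = 1 -> r [set y] = 1 -> r [set x; y] <= 1 -> P \subset Q.
  move=> PP QP xP yQ x1 y1 xy; apply/subsetP => z zP.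
  apply: (flatP Q y z) => //; apply: (@parallel_trans _ _ _ x); rewrite ?x1 //.
    by rewrite setUC.
  move: PP; rewrite inE => /andP[_ /eqP <-]; apply: rank_sub => //.
  by rewrite subUset !sub1set xP.
have hP P : P \in Ps -> exists x, [/\ h P = Some x, x \in P & r [set x] = 1].
  move=> PP; rewrite /h; case: pickP => [x /andP[xP /eqP x1]|no]; first by exists x.
  move: PP; rewrite inE => /andP[_ /eqP P1].
  have [|x xP] := @rank_ex_U1 _ _ rM set0 P; first by rewrite set0U rank0 // P1.
  by rewrite setU0 rank0 // => x1; have := no x; rewrite xP x1 eqxx.
exists [set x | Some x \in h @: Ps].
  move=> x y; rewrite !inE => /imsetP[P PP hx] /imsetP[Q QP hy].
  have [x' [hx' xP x1]] := hP P PP; have [y' [hy' yQ y1]] := hP Q QP.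
  move: hx' hy'; rewrite -hx -hy => -[xx'] [yy']; subst x' y'.
  have [->|xy] := eqVneq x y; first by rewrite setUid y1.
  apply/eqP; rewrite eqn_leq; apply/andP; split.
    by have := rankU rM [set x] [set y]; lia.
  rewrite ltnNge; apply/negP => xy1.
  have PQ : P = Q.
    apply/eqP; rewrite eqEsubset (subPQ P Q x y) // (subPQ Q P y x) // setUC //.
  by move: hy xy; rewrite -PQ -hx => -[->]; rewrite eqxx.
have hI : {in Ps &, injective h}.
  move=> P Q PP QP hPQ; have [x [hx xP x1]] := hP P PP; have [y [hy yQ y1]] := hP Q QP.
  move: hx; rewrite hPQ hy => -[yx]; subst y.
  by apply/eqP; rewrite eqEsubset (subPQ P Q x x) ?(subPQ Q P x x) // setUid x1.
have SI : injective (@Some T) by move=> ? ? [].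
rewrite -(card_in_imset hI) -(card_imset _ SI); congr #|pred_of_set _|.
apply/setP=> o; apply/imsetP/idP => [[x]|]; first by rewrite inE => ? ->.
move=> oP; have /imsetP[P PP oh] := oP; have [x [hx _ _]] := hP P PP.
by exists x; rewrite ?inE -?hx -?oh.
Qed.

Lemma rank_simple_line (T : finType) (r : {set T} -> nat) (S : {set T}) :
  is_matroid r -> simple_set r S -> r S <= 2 -> r S = minn #|S| 2.
Proof.
move=> rM Ss S2; have [S1|S1] := ltnP 1 #|S|; first by rewrite (simple_line_rank rM) //; lia.
have [S0|S0] := posnP #|S|.
  by rewrite (cards0_eq S0) rank0 // cards0.
have /cards1P[x Sx] : #|S| == 1 by lia.
by rewrite Sx cards1 -[in LHS](setUid [set x]) Ss ?eqxx // Sx inE.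
Qed.

(** Any [m.+1] elements of a longer line of M/K give the forbidden minor; they avoid [K], whose
    elements are loops of M/K. *)
Lemma short_lines_no_minor (T : finType) (r : {set T} -> nat) (m : nat) :
  is_matroid r -> ~ has_minor r (@U2_rank m.+1) -> short_lines r m.
Proof.
move=> rM nU K S Ss S2; rewrite leqNgt; apply/negP => Sm; apply: nU.
pose f (i : 'I_m.+1) : T := enum_val (widen_ord Sm i).
have fI : injective f by move=> i j /enum_val_inj/(congr1 val) /= /val_inj.
have fS i : f i \in S by apply: enum_valP.
have KM := contract_matroid rM K.
exists K, f; split=> // [|X].
  rewrite disjoint_subset; apply/subsetP => _ /imsetP[i _ ->].
  rewrite inE; apply/negP => fK; have := Ss _ _ (fS i) (fS i).
  by rewrite setUid eqxx /contract (setUidPr _) ?sub1set // subnn.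
have XS : f @: X \subset S by apply/subsetP => _ /imsetP[i _ ->].
rewrite -/(contract r K (f @: X)) (rank_simple_line KM) ?card_imset //.
  exact: simple_set_sub XS.
exact: leq_trans (rank_sub KM XS) S2.
Qed.

Lemma ex_normalized (F : finFieldType) (n : nat) (v : 'rV[F]_n) :
  v != 0%R -> exists2 c : F, c != 0%R & normalized (c *: v)%R.
Proof.
case/rV0Pn => i0 vi0.
case: (@arg_minnP _ i0 (fun i => v 0 i != 0)%R (fun i : 'I_n => i : nat)) => // i vi imin.
exists (v 0 i)^-1%R; first by rewrite invr_eq0.
apply/existsP; exists i; rewrite mxE mulVf // eqxx /=.
apply/forallP => j; apply/implyP => ji; rewrite mxE mulf_eq0 invr_eq0 (negPf vi) /=.
by apply: contraTT ji => /imin; rewrite -leqNgt.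
Qed.

(** Composing [f] with the choice [nm] of a normalized vector on the same 1-space extends it to all
    nonzero vectors without changing spans. *)
Lemma vector_rep_PG (F : finFieldType) (n : nat) (T : finType)
    (r : {set T} -> nat) : is_matroid r -> 0 < n -> has_minor r (@PG_rank F n) ->
  exists (C : {set T}) (g : 'rV[F]_n -> T), vector_rep r C g.
Proof.
move=> rM n0 [C [f [_ _ fP]]].
(* Some normalized vector is required as the default value of [nm]; it exists because [0 < n]. *)
have [v0 v00] : exists v : 'rV[F]_n, v != 0%R.
  exists (const_mx 1%R); apply/rV0Pn; exists (Ordinal n0).
  by rewrite mxE oner_eq0.
have [c0 _ nc0] := ex_normalized v00.
pose prop (v : 'rV[F]_n) (p : PGpt F n) := <[v]>%VS == <[val p]>%VS.
pose nm v : PGpt F n := odflt (Sub _ nc0) [pick p : PGpt F n | prop v p].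
have nmP v : v != 0%R -> <[v]>%VS = <[val (nm v)]>%VS.
  move=> vn0; rewrite /nm; case: pickP => [p /eqP//|no].
  have [c cn0 nc] := ex_normalized vn0; have /negP[] := negbT (no (Sub _ nc)).
  rewrite /prop /= eqEsubv; apply/andP; split; rewrite -memvE; last first.
    by rewrite memvZ // memv_line.
  by apply/vlineP; exists c^-1%R; rewrite scalerA mulVf // scale1r.
exists C, (f \o nm) => s s0.
have -> : [set x in map (f \o nm) s] = f @: [set p in map nm s].
  apply/setP => x; rewrite inE; apply/mapP/imsetP => [[v vs ->]|[p]].
    by exists (nm v); rewrite // inE map_f.
  by rewrite inE => /mapP[v vs ->] ->; exists v.
have := fP [set p in map nm s]; rewrite /PG_rank.
have -> : <<[seq val x | x <- enum [set p in map nm s]]>>%VS = <<s>>%VS.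
  have sn0 v : v \in s -> v != 0%R by move=> vs; apply: contraNneq s0 => <-.
  apply/eqP; rewrite eqEsubv; apply/andP; split; apply/span_subvP => v.
    case/mapP => p; rewrite mem_enum inE => /mapP[w ws ->] ->.
    by rewrite memvE -nmP ?sn0 // -memvE memv_span.
  move=> vs; rewrite memvE nmP ?sn0 // -memvE memv_span //.
  by apply/mapP; exists (nm v); rewrite // mem_enum inE map_f.
by move=> ->; rewrite subnKC //; apply/rank_sub/subsetUr.
Qed.

Theorem theorem1p3 (q : nat) : prime_power q ->
  exists n : nat, (0 < n)%N /\
    forall (T : finType) (r : {set T} -> nat),
      is_matroid r -> round r ->
      (exists F : finFieldType, #|F| = q /\ has_minor r (@PG_rank F n)) ->
      ~ has_minor r (@U2_rank (q ^ 2).+1) ->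
      (num_points r <= (q ^ (r setT) - 1) %/ (q - 1))%N.
Proof.
move=> _; have [n n3 Hn] := card_simple_minor q.
exists n; split=> [|T r rM rR [F [Fq Fm]] nU]; first exact: ltn_trans n3.
have q1 : 1 < q by rewrite -Fq; apply/card_gt1P; exists 0%R, 1%R; rewrite eq_sym oner_neq0.
have [C [g gP]] := vector_rep_PG rM (ltn_trans (isT : 0 < 2) n3) Fm.
have [S Ss <-] := num_points_simple rM.
rewrite leq_divRL ?subn_gt0 // mulnC.
exact: Hn Fq rM rR (short_lines_no_minor rM nU) gP Ss.
Qed.
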